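(* Fix an integer $n>0$. (I) Let $g_1\in L_{fin}SU(1,1)$ and consider the following three statements. (I.1) $g_1$ is of the form $g_1(z)=\begin{pmatrix} a(z)&b(z)\\ b^*(z)&a^*(z)\end{pmatrix}$, $z\in S^1$, where $a$ and $b$ are polynomials in $z$ of order at most $n$, with $a(0)>0$. (I.2) $g_1$ has a factorization $$g_1(z)=\mathbf a(\eta_n)\begin{pmatrix} 1&\bar{\eta}_nz^n\\ \eta_nz^{-n}&1\end{pmatrix}\cdots\mathbf a(\eta_0)\begin{pmatrix} 1&\bar{\eta}_0\\ \eta_0&1\end{pmatrix}$$ (factors with indices $n,n-1,\dots,0$ from left to right) for some $\eta_0,\dots,\eta_n\in\Delta$. (I.3) $g_1$ has a triangular factorization $$g_1=\begin{pmatrix} 1&0\\ \sum_{j=0}^n \bar y_jz^{-j}&1\end{pmatrix}\begin{pmatrix} a_1&0\\ 0&a_1^{-1}\end{pmatrix}\begin{pmatrix} \alpha_1 (z)&\beta_1 (z)\\ \gamma_1 (z)&\delta_1 (z)\end{pmatrix},$$ where $y_j\in\mathbb C$, $a_1>0$, and the third factor is a matrix valued polynomial in $z$ which is unipotent upper triangular at $z=0$. Then (I.1) and (I.3) are equivalent, and (I.2) implies (I.1) and (I.3). If $g_1$ is in the identity connected component of the set of loops satisfying (I.1) (equivalently (I.3)), then the converse holds, i.e. $g_1$ has a factorization as in (I.2). (II) Let $g_2\in L_{fin}SU(1,1)$ and consider the following three statements. (II.1) $g_2$ is of the form $g_2(z)=\begin{pmatrix} d^{*}(z)&c^{*}(z)\\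 c(z)&d(z)\end{pmatrix}$, $z\in S^1$, where $c$ and $d$ are polynomials in $z$ of order at most $n$ and at most $n-1$, respectively, with $c(0)=0$ and $d(0)>0$. (II.2) $g_2$ has a factorization $$g_2(z)=\mathbf a(\zeta_n)\begin{pmatrix} 1&\zeta_nz^{-n}\\ \bar{\zeta}_nz^n&1\end{pmatrix}\cdots\mathbf a(\zeta_1)\begin{pmatrix} 1&\zeta_1z^{-1}\\ \bar{\zeta}_1z&1\end{pmatrix}$$ (factors with indices $n,n-1,\dots,1$ from left to right) for some $\zeta_1,\dots,\zeta_n\in\Delta$. (II.3) $g_2$ has a triangular factorization $$g_2=\begin{pmatrix} 1&\sum_{j=1}^n \bar x_jz^{-j}\\ 0&1\end{pmatrix}\begin{pmatrix} a_2&0\\ 0&a_2^{-1}\end{pmatrix}\begin{pmatrix} \alpha_2 (z)&\beta_2 (z)\\ \gamma_2 (z)&\delta_2 (z)\end{pmatrix},$$ where $x_j\in\mathbb C$, $a_2>0$, and the third factor is a matrix valued polynomial in $z$ which is unipotent upper triangular at $z=0$. Then (II.1) and (II.3) are equivalent, and (II.2) implies (II.1) and (II.3). If $g_2$ is in the identity connected component of the set of loops satisfying (II.1) (equivalently (II.3)), then $g_2$ has a factorization as in (II.2). Moreover, when $g_1$ and $g_2$ have factorizations as in (I.2) and (II.2), the scalars determining the diagonal factors in (I.3) and (II.3) are given by $$a_1=\prod_{i=0}^n \mathbf a(\eta_i)\quad\text{and}\quad a_2^{-1}=\prod_{k=1}^n \mathbf a(\zeta_k),$$ respectively.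
   Context: $\Delta=\{\zeta\in\mathbb C:|\zeta|<1\}$ and $\mathbf a(\zeta)=(1-|\zeta|^2)^{-1/2}$ for $\zeta\in\Delta$. $SU(1,1)$ is the group of matrices $\begin{pmatrix} a&b\\ \bar b&\bar a\end{pmatrix}$ with $|a|^2-|b|^2=1$. $L_{fin}SU(1,1)$ is the group (under pointwise multiplication) of maps $S^1\to SU(1,1)$ whose matrix entries have finite Fourier series in $z\in S^1$. For a Laurent series $f(z)=\sum f_nz^n$, $f^*(z)=\sum\bar f_nz^{-n}$ (so $f^*=\bar f$ on $S^1$). A matrix is unipotent upper triangular if it is upper triangular with ones on the diagonal. For fixed $n$, the set of loops satisfying (I.1) (resp. (II.1)) lies in a finite dimensional space of Laurent polynomial matrices and is given the usual topology; its identity connected component is the connected component containing the constant loop $1$. *)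

(* Defs.v *)
From HB Require Import structures.
From mathcomp Require Import all_boot all_order all_algebra.
From mathcomp Require Import complex.
From mathcomp Require Import boolp classical_sets functions reals topology normedtype.

Set Implicit Arguments.
Unset Strict Implicit.
Unset Printing Implicit Defensive.

Import Order.TTheory GRing.Theory Num.Theory.
Import numFieldNormedType.Exports.
Local Open Scope classical_set_scope.
Local Open Scope ring_scope.

(* The definitions are generic in the field C, which is to be instantiated by
   the complex numbers R[i] over R : realType: a generic numClosedFieldType
   carries the topology of its norm, while R[i] itself has no canonical one.
   In C, [0 < x] and [`|x| < 1] refer to the partial order in which comparable
   elements differ by a real number: [0 < x] says that x is real and
   positive. *)

Definition mx2 (T : Type) (a b c d : T) : 'M[T]_2 :=
  \matrix_(i, j) if i == ord0 then (if j == ord0 then a else b)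
                 else (if j == ord0 then c else d).

Section Loops.
Variable C : numClosedFieldType.
Implicit Types n : nat.

Definition circle := {z : C | `|z| == 1}.

Definition loop := circle -> 'M[C]_2.

Definition SU11 : set 'M[C]_2 :=
  [set M | exists a b : C,
     `|a| ^+ 2 - `|b| ^+ 2 = 1 /\ M = mx2 a b (b^*) (a^*)].

(* The k-th entry of A is the coefficient of z^(k - N), for 0 <= k <= 2 N. *)
Definition laurent (N : nat) (A : 'rV['M[C]_2]_(N.*2.+1)) : loop :=
  fun z => \sum_(k < N.*2.+1) (val z) ^ (k%:Z - N%:Z) *: A ord0 k.

Definition Lfin_SU11 : set loop :=
  [set g | (forall z, SU11 (g z)) /\
           exists N (A : 'rV['M[C]_2]_(N.*2.+1)), g = laurent A].

(* Coefficients of the constant loop 1. *)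
Definition laurent_one (N : nat) : 'rV['M[C]_2]_(N.*2.+1) :=
  \row_k if k == N :> nat then 1 else 0.

(* Identity component of a set S of loops with frequencies in [-N, N]. The map
   [laurent] is a linear isomorphism from the space of coefficients onto the
   space of such loops, which thereby receives its usual topology. *)
Definition id_component (N : nat) (S : set loop) : set loop :=
  @laurent N @` connected_component (@laurent N @^-1` S) (laurent_one N).

(* Value at z of f^* for a polynomial f. *)
Definition pstar (f : {poly C}) (z : C) : C := (map_poly Num.conj f).[z^-1].

Definition mxeval (M : 'M[{poly C}]_2) (z : C) : 'M[C]_2 :=
  map_mx (fun p : {poly C} => p.[z]) M.

(* [is_trig_mx] means lower triangular, hence the transpose. *)
Definition unipotent_upper (A : 'M[C]_2) : Prop :=
  is_trig_mx A^T /\ forall i, A i i = 1.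

Definition fa (w : C) : C := (sqrtC (1 - `|w| ^+ 2))^-1.

Definition form1 n (g : loop) : Prop :=
  exists a b : {poly C},
    [/\ (size a <= n.+1)%N, (size b <= n.+1)%N, 0 < a.[0] &
        forall z : circle, let t := val z in
          g z = mx2 a.[t] b.[t] (pstar b t) (pstar a t)].

Definition factor1 (i : nat) (eta z : C) : 'M[C]_2 :=
  fa eta *: mx2 1 (eta^* * z ^+ i) (eta * z ^- i) 1.

(* Only eta 0, ..., eta n matter; the index n - i makes the factors appear with
   indices n, ..., 0 from left to right. *)
Definition factorization1 n (g : loop) (eta : nat -> C) : Prop :=
  (forall i, (i <= n)%N -> `|eta i| < 1) /\
  forall z : circle,
    g z = \prod_(i < n.+1) factor1 (n - i)%N (eta (n - i)%N) (val z).

Definition triangular1 n (g : loop)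
    (y : nat -> C) (a1 : C) (M : 'M[{poly C}]_2) : Prop :=
  [/\ 0 < a1, unipotent_upper (mxeval M 0) &
      forall z : circle, let t := val z in
        g z = mx2 1 0 (\sum_(0 <= j < n.+1) (y j)^* * t ^- j) 1
              *m mx2 a1 0 0 a1^-1 *m mxeval M t].

Definition form2 n (g : loop) : Prop :=
  exists c d : {poly C},
    [/\ (size c <= n.+1)%N, (size d <= n)%N, c.[0] = 0, 0 < d.[0] &
        forall z : circle, let t := val z in
          g z = mx2 (pstar d t) (pstar c t) c.[t] d.[t]].

Definition factor2 (k : nat) (zeta z : C) : 'M[C]_2 :=
  fa zeta *: mx2 1 (zeta * z ^- k) (zeta^* * z ^+ k) 1.

(* Only zeta 1, ..., zeta n matter; the factors appear with indices n, ..., 1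
   from left to right. *)
Definition factorization2 n (g : loop) (zeta : nat -> C) : Prop :=
  (forall k, (0 < k <= n)%N -> `|zeta k| < 1) /\
  forall z : circle,
    g z = \prod_(i < n) factor2 (n - i)%N (zeta (n - i)%N) (val z).

Definition triangular2 n (g : loop)
    (x : nat -> C) (a2 : C) (M : 'M[{poly C}]_2) : Prop :=
  [/\ 0 < a2, unipotent_upper (mxeval M 0) &
      forall z : circle, let t := val z in
        g z = mx2 1 (\sum_(1 <= j < n.+1) (x j)^* * t ^- j) 0 1
              *m mx2 a2 0 0 a2^-1 *m mxeval M t].

Definition has_factorization1 n g := exists eta, factorization1 n g eta.
Definition has_factorization2 n g := exists zeta, factorization2 n g zeta.
Definition has_triangular1 n g := exists y a1 M, triangular1 n g y a1 M.
Definition has_triangular2 n g := exists x a2 M, triangular2 n g x a2 M.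

End Loops.

(* Main.v *)
Require Import Defs.
From HB Require Import structures.
From mathcomp Require Import all_boot all_order all_algebra.
From mathcomp Require Import complex ring.
From mathcomp Require Import boolp classical_sets functions reals topology normedtype.

Set Implicit Arguments.
Unset Strict Implicit.
Unset Printing Implicit Defensive.

Import Order.TTheory GRing.Theory Num.Theory.
Import numFieldNormedType.Exports.
Local Open Scope classical_set_scope.
Local Open Scope ring_scope.

(** The loops of both parts are governed by a pair of polynomials a, b of degree
   at most n with a a^* - b b^* = 1 on the circle and a(0) > 0. For part (II)
   the pair is (d, c) with c(0) = 0: conjugation by the permutation matrix
   exchanges the two shapes of loops and of elementary factors, and part (II)
   becomes part (I) with eta_0 = 0 (swap_loop, swap_factorization).

   Triangular factorization. The first row of g determines the upper factor, and
   the lower factor is the truncated quotient of b^* by a in powers of z. Since a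
   is prime to every power of z, Bezout provides this quotient, and a a^* -
   b b^* = 1 forces the second row of the remaining factor to be polynomial
   (triangular_quotient). Conversely a triangular factorization shows that the
   first row is polynomial, and the SU(1,1) symmetry between the rows bounds the
   degrees (size_le_of_conj). The diagonal scalar is a_1 = a(0), and a_2^-1 = d(0)
   in part (II).

   Elementary factors. Multiplying by the factor of index m multiplies a(0) by
   fa(eta_m) > 0, whence the product formula (factorization_pair).
   Conversely, eta_m is forced: its conjugate is b_m / a(0), and then the top
   coefficients of both polynomials cancel, those of a because of the coefficient
   of z^m in a a^* - b b^* = 1. This is a step of the Schur algorithm; it succeeds
   as long as |b_m| < a(0) (schur_pos_factorization).

   Connectedness. The inequality |b_m| < a(0) can fail, but not on the identity
   component, as the loops for which the algorithm succeeds at every step form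
   an open and closed subset. It is clearly open. It is closed since a(0) is a
   product of scalars >= 1 when the algorithm succeeds, so that the strict
   inequality a(0) > 0 at each stage improves by itself to a(0) >= 1, which
   survives limits (schur_pos_bound, schur_bound_pos). To have continuous
   quantities, the steps are carried out without division or square root: after
   a step the pair satisfies a a^* - b b^* = D with a constant D that need not be
   1, and a(0) >= 1 turns into inequalities between a(0) and D (schur_bound). *)

(** * Two by two matrices *)

Section Mx2.
Variable K : comNzRingType.
Implicit Types a b c d : K.

Lemma mx2E (M : 'M[K]_2) : M = mx2 (M ord0 ord0) (M ord0 1) (M 1 ord0) (M 1 1).
Proof.
apply/matrixP=> -[[|[|//]] ?] [[|[|//]] ?]; rewrite mxE /=;
  by congr (M _ _); apply: val_inj.
Qed.

Lemma mx2_inj a b c d a' b' c' d' :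
  mx2 a b c d = mx2 a' b' c' d' -> [/\ a = a', b = b', c = c' & d = d'].
Proof.
by move/matrixP=> e; split; [have := e ord0 ord0|have := e ord0 1|
  have := e 1 ord0|have := e 1 1]; rewrite !mxE.
Qed.

Lemma mul_mx2 a b c d a' b' c' d' :
  mx2 a b c d *m mx2 a' b' c' d' =
  mx2 (a * a' + b * c') (a * b' + b * d') (c * a' + d * c') (c * b' + d * d').
Proof.
by rewrite [LHS]mx2E; congr mx2; rewrite !mxE !big_ord_recl big_ord0 !mxE addr0.
Qed.

Lemma scale_mx2 k a b c d :
  k *: mx2 a b c d = mx2 (k * a) (k * b) (k * c) (k * d).
Proof. by rewrite [LHS]mx2E; congr mx2; rewrite !mxE. Qed.

Lemma mx2_1 : mx2 1 0 0 1 = 1 :> 'M[K]_2.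
Proof. by rewrite [RHS]mx2E; congr mx2; rewrite !mxE. Qed.

(** Conjugation by the permutation matrix. *)
Definition swapmx (M : 'M[K]_2) :=
  mx2 (M 1 1) (M 1 ord0) (M ord0 1) (M ord0 ord0).

Lemma swap_mx2 a b c d : swapmx (mx2 a b c d) = mx2 d c b a.
Proof. by rewrite /swapmx !mxE. Qed.

Lemma swapmxK : involutive swapmx.
Proof. by move=> M; rewrite {2}/swapmx swap_mx2 -mx2E. Qed.

Lemma swapmxM : {morph swapmx : M N / M *m N}.
Proof.
move=> M N; rewrite [M]mx2E [N]mx2E !(mul_mx2, swap_mx2).
by congr mx2; exact: addrC.
Qed.

End Mx2.

(** * Polynomials on the unit circle *)

Section Pairs.
Variable C : numClosedFieldType.
Implicit Types (a b p q : {poly C}) (t w D : C) (m n : nat).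

Lemma circle_conj t : `|t| = 1 -> t^* = t^-1.
Proof. by move=> t1; rewrite invC_norm t1 expr1n invr1 mul1r. Qed.

Lemma circle_neq0 t : `|t| = 1 -> t != 0.
Proof. by move=> t1; rewrite -normr_eq0 t1 oner_eq0. Qed.

Lemma pstar_circle p t : `|t| = 1 -> pstar p t = (p.[t])^*.
Proof. by move=> t1; rewrite /pstar -circle_conj // horner_map. Qed.

(** The quotients w / w^* with w = 1 + i k, for k natural, are infinitely many
   points of the circle. *)
Lemma circle_poly_eq p q : (forall t, `|t| = 1 -> p.[t] = q.[t]) -> p = q.
Proof.
move=> pq; apply/eqP; rewrite -subr_eq0; apply/eqP.
pose w (k : nat) : C := 1 + 'i * k%:R; pose pt k := w k / (w k)^*.
have wC k : (w k)^* = 1 - 'i * k%:R.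
  by rewrite rmorphD rmorphM /= conjC1 conjCi conjC_nat mulNr.
have w0 k : w k != 0.
  apply/eqP=> wk; have : w k + (w k)^* = 2%:R by rewrite wC /w; ring.
  by move/eqP; rewrite wk conjC0 addr0 eq_sym pnatr_eq0.
have pt1 k : `|pt k| = 1 by rewrite normf_div norm_conjC divff // normr_eq0.
have pt_inj : injective pt.
  move=> k l /eqP; rewrite eqr_div ?conjC_eq0 // !wC => /eqP e.
  have /eqP : 'i * (k%:R - l%:R) * 2%:R = 0 :> C.
    by rewrite -[RHS](subrr (w k * (1 - 'i * l%:R))) {2}e /w; ring.
  rewrite !mulf_eq0 (negPf (neq0Ci _)) pnatr_eq0 orbF subr_eq0 eqr_nat.
  by move/eqP.
apply: (@roots_geq_poly_eq0 _ _ (map pt (iota 0 (size (p - q))))).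
- by apply/allP=> _ /mapP[k _ ->]; rewrite rootE hornerD hornerN pq ?subrr.
- by rewrite map_inj_uniq // iota_uniq.
- by rewrite size_map size_iota.
Qed.

(** The reciprocal polynomial z^m p^*(z) at formal degree m: it keeps the
   relations between the Laurent polynomials a, a^*, b, b^* inside the polynomial
   ring. *)
Definition recip m p : {poly C} := \poly_(k < m.+1) (p`_(m - k))^*.

Lemma size_recip m p : (size (recip m p) <= m.+1)%N.
Proof. exact: size_poly. Qed.

Lemma coef_recip m p k :
  (recip m p)`_k = if (k <= m)%N then (p`_(m - k))^* else 0.
Proof. exact: coef_poly. Qed.

Lemma coef_recip0 m p : (recip m p)`_0 = (p`_m)^*.
Proof. by rewrite coef_recip subn0. Qed.

Lemma recipB m p q : recip m (p - q) = recip m p - recip m q.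
Proof.
apply/polyP=> k; rewrite coefB !coef_recip; case: ifP => _;
  last by rewrite subr0.
by rewrite coefB rmorphB.
Qed.

Lemma recipZ m w p : recip m (w *: p) = w^* *: recip m p.
Proof.
apply/polyP=> k; rewrite coefZ !coef_recip; case: ifP => _;
  last by rewrite mulr0.
by rewrite coefZ rmorphM.
Qed.

Lemma recipK m p : (size p <= m.+1)%N -> recip m (recip m p) = p.
Proof.
move=> sp; apply/polyP=> k; rewrite !coef_recip leq_subr; case: leqP => km.
  by rewrite subKn // conjCK.
by rewrite nth_default // (leq_trans sp).
Qed.

Lemma recip_widen m p : (size p <= m.+1)%N -> recip m.+1 p = recip m p * 'X.
Proof.
move=> sp; apply/polyP=> -[|k]; rewrite coefMX !coef_recip /=.
  by rewrite nth_default // conjC0.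
by rewrite ltnS subSS.
Qed.

Lemma horner_recip m p t :
  (size p <= m.+1)%N -> `|t| = 1 -> (recip m p).[t] = t ^+ m * (p.[t])^*.
Proof.
move=> sp t1; rewrite horner_poly (horner_coef_wide _ sp) rmorph_sum mulr_sumr.
rewrite (reindex_inj rev_ord_inj) /=; apply: eq_bigr => i _.
rewrite subSS subKn -1?ltnS // rmorphM rmorphXn /= (circle_conj t1).
by rewrite exprB -1?ltnS ?unitfE ?circle_neq0 // exprVn mulrCA.
Qed.

(** * Pairs of polynomials and the Schur step *)

Definition su11_mx a b t := mx2 a.[t] b.[t] (b.[t])^* (a.[t])^*.

(** The equation says a a^* - b b^* = D on the circle. It is unchanged when
   a is multiplied by a unimodular constant, so that the reality of a(0) has to
   be a separate condition. *)
Definition su11_pair m D a b :=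
  [/\ (size a <= m.+1)%N, (size b <= m.+1)%N, a`_0 \is Num.real &
      a * recip m a - b * recip m b = D *: 'X^m].

Lemma su11_pair_circle m a b :
  (size a <= m.+1)%N -> (size b <= m.+1)%N -> a`_0 \is Num.real ->
  (forall t, `|t| = 1 -> `|a.[t]| ^+ 2 - `|b.[t]| ^+ 2 = 1) ->
  su11_pair m 1 a b.
Proof.
move=> sa sb a0 ab; split=> //; apply: circle_poly_eq => t t1.
rewrite scale1r hornerXn hornerD hornerN !hornerM !horner_recip //.
by rewrite ![_ * (t ^+ m * _)]mulrCA -!normCK -mulrBr ab ?mulr1.
Qed.

(** Compare the coefficients of z^m in a a^* - b b^* = D. *)
Lemma su11_pair_top m D a b : (0 < m)%N -> su11_pair m D a b ->
  a`_m * (a`_0)^* = b`_m * (b`_0)^*.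
Proof.
have top p : (size p <= m.+1)%N -> (p * recip m p)`_(m + m) = p`_m * (p`_0)^*.
  move=> sp; rewrite coefM.
  have mm : (m < (m + m).+1)%N by rewrite ltnS leq_addr.
  rewrite (bigD1 (Ordinal mm)) //= addnK coef_recip leqnn subnn big1 ?addr0 //.
  move=> i; rewrite -val_eqE /= neq_ltn => /orP[] im.
    by rewrite coef_recip leqNgt ltn_subRL ltn_add2r im mulr0.
  by rewrite (nth_default _ (leq_trans sp im)) mul0r.
move=> m0 [sa sb _ /(congr1 (fun p : {poly C} => p`_(m + m)))].
rewrite coefB !top // coefZ coefXn -[X in _ == X]addn0 eqn_add2l (gtn_eqF m0) /=.
rewrite mulr0.
by move/eqP; rewrite subr_eq0 => /eqP.
Qed.

(** Up to the positive factor a(0) and a square root, this is the multiplication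
   on the left by the inverse of the elementary factor whose parameter has
   conjugate b_m / a(0). *)
Definition schur_a m a b := a`_0 *: a - b`_m *: recip m b.
Definition schur_b m a b := a`_0 *: b - b`_m *: recip m a.

Lemma schur_a0 m a b : a`_0 \is Num.real ->
  (schur_a m a b)`_0 = a`_0 ^+ 2 - `|b`_m| ^+ 2.
Proof. by move=> a0; rewrite coefB !coefZ coef_recip0 normCK expr2. Qed.

Lemma size_schur_step m p q u v : (size p <= m.+2)%N -> 
  u * p`_m.+1 = v * (q`_0)^* -> (size (u *: p - v *: recip m.+1 q)%R <= m.+1)%N.
Proof.
move=> sp e; apply/leq_sizeP => j; rewrite leq_eqVlt => /orP[/eqP<-|mj].
  by rewrite coefB !coefZ coef_recip leqnn subnn e subrr.
rewrite coefB !coefZ coef_recip leqNgt mj nth_default ?(leq_trans sp) //.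
by rewrite !mulr0 subrr.
Qed.

(** The step removes the top coefficients: the one of b by the choice of the
   parameter, the one of a by su11_pair_top. *)
Lemma su11_pair_step m D a b : su11_pair m.+1 D a b ->
  su11_pair m ((schur_a m.+1 a b)`_0 * D) (schur_a m.+1 a b) (schur_b m.+1 a b).
Proof.
move=> ab; have top := su11_pair_top (ltn0Sn m) ab; have [sa sb a0 e] := ab.
have sa' : (size (schur_a m.+1 a b) <= m.+1)%N.
  by apply: size_schur_step => //; rewrite -top conj_Creal // mulrC.
have sb' : (size (schur_b m.+1 a b) <= m.+1)%N.
  by apply: size_schur_step => //; rewrite conj_Creal // mulrC.
split=> //; first by rewrite schur_a0 // rpredB ?rpredX ?normr_real.
(* Lowering the formal degree by one divides both reciprocals by 'X. *)
apply: (mulIf (negbT (polyX_eq0 C))); rewrite mulrBl -!mulrA -!recip_widen //.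
rewrite schur_a0 // /schur_a /schur_b !recipB !recipZ !recipK // conj_Creal //.
rewrite -scalerA -!scalerAl -exprSr -e scalerBl normCK expr2 -!scalerA.
rewrite -!mul_polyC.
ring.
Qed.

Lemma schur_b0 m a b : (schur_b m a b)`_0 = a`_0 * b`_0 - b`_m * (a`_m)^*.
Proof. by rewrite coefB !coefZ coef_recip0. Qed.

Lemma su11_pair0 D a b : su11_pair 0 D a b -> D = a`_0 ^+ 2 - `|b`_0| ^+ 2.
Proof.
case=> _ _ a0 /(congr1 (fun p : {poly C} => p`_0)).
rewrite coefB !coef0M !coef_recip0 coefZ coefXn eqxx mulr1 => <-.
by rewrite conj_Creal // normCK expr2.
Qed.

(** * Success of the Schur algorithm *)

Fixpoint schur_pos m a b : Prop :=
  0 < a`_0 /\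
  if m is k.+1 then schur_pos k (schur_a m a b) (schur_b m a b) else True.

(** The closed counterpart of schur_pos. The number a'(0)^2 / D', where a' and
   D' = a'(0) D come from the step, is the square of the value at 0 of the
   normalized pair; the inequality D <= a'(0) says that it is at least 1. *)
Fixpoint schur_bound m D a b : Prop :=
  if m is k.+1 then
    D <= (schur_a m a b)`_0 /\
    schur_bound k ((schur_a m a b)`_0 * D) (schur_a m a b) (schur_b m a b)
  else True.

Lemma schur_pos_gt0 m a b : schur_pos m a b -> 0 < a`_0.
Proof. by case: m => [|m] []. Qed.

(** The normalized value at 0 is at least 1 when the algorithm succeeds: at level
   0 since a(0)^2 = D + |b(0)|^2, and passing to a lower level decreases it. *)
Lemma schur_pos_le m D a b : su11_pair m D a b -> 0 < D -> schur_pos m a b ->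
  D <= a`_0 ^+ 2.
Proof.
elim: m D a b => [|m IH] D a b ab D0.
  by move=> _; rewrite (su11_pair0 ab) lerBlDr lerDl exprn_ge0.
case=> a0 pos; have := schur_pos_gt0 pos; set a' := (schur_a _ _ _)`_0 => a'0.
have := IH _ _ _ (su11_pair_step ab) (mulr_gt0 a'0 D0) pos.
rewrite -/a' expr2 ler_pM2l // => /le_trans; apply.
by rewrite /a' schur_a0 ?gtr0_real // lerBlDr lerDl exprn_ge0.
Qed.

Lemma schur_pos_bound m D a b : su11_pair m D a b -> 0 < D -> schur_pos m a b ->
  schur_bound m D a b.
Proof.
elim: m D a b => [|m IH] D a b ab D0 //= [a0 pos].
have a'0 := schur_pos_gt0 pos; have D'0 := mulr_gt0 a'0 D0.
have ab' := su11_pair_step ab; split; last exact: IH.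
by have := schur_pos_le ab' D'0 pos; rewrite expr2 ler_pM2l.
Qed.

(** The bound gives a'(0) >= D > 0 for the stage after the step, hence also
   D' = a'(0) D > 0, and so on downwards. *)
Lemma schur_bound_pos m D a b : 0 < D -> 0 < a`_0 ->
  schur_bound m D a b -> schur_pos m a b.
Proof.
elim: m D a b => [|m IH] D a b D0 a0 //= [le bd].
have a'0 := lt_le_trans D0 le.
by split=> //; apply: IH bd; rewrite ?mulr_gt0.
Qed.

Lemma fa_quotient x w : 0 < x -> 0 < x ^+ 2 - `|w| ^+ 2 ->
  fa (w / x) = x / sqrtC (x ^+ 2 - `|w| ^+ 2).
Proof.
move=> x0 c0; have x_neq0 : x != 0 by rewrite gt_eqF.
rewrite /fa normf_div (gtr0_norm x0) expr_div_n.
have -> : 1 - `|w| ^+ 2 / x ^+ 2 = (x ^+ 2 - `|w| ^+ 2) / x ^+ 2 by field.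
rewrite sqrtCM ?nnegrE ?invr_ge0 ?exprn_ge0 ?ltW //.
by rewrite -exprVn sqrCK ?invr_ge0 ?ltW // invfM invrK mulrC.
Qed.

Lemma quotient_lt1 x w : 0 < x -> 0 < x ^+ 2 - `|w| ^+ 2 -> `|w / x| < 1.
Proof.
move=> x0; rewrite subr_gt0 ltr_pXn2r ?nnegrE ?normr_ge0 ?ltW // => wx.
by rewrite normf_div (gtr0_norm x0) ltr_pdivrMr // mul1r.
Qed.

(** One elementary factor is split off on the left. *)
Lemma su11_mx_peel m a b t (c := a`_0 ^+ 2 - `|b`_m| ^+ 2) : `|t| = 1 ->
  (size a <= m.+1)%N -> (size b <= m.+1)%N -> 0 < a`_0 -> 0 < c ->
  su11_mx a b t = (sqrtC c)^-1 *: (factor1 m ((b`_m)^* / a`_0) t *m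
    su11_mx (schur_a m a b) (schur_b m a b) t).
Proof.
move=> t1 sa sb a0 c0.
have x0 : a`_0 != 0 by rewrite gt_eqF.
have xC : (a`_0)^* = a`_0 by rewrite conj_Creal // gtr0_real.
have T0 : t ^+ m != 0 by rewrite expf_neq0 ?circle_neq0.
have TC : (t ^+ m)^* = (t ^+ m)^-1 by rewrite rmorphXn /= circle_conj // exprVn.
rewrite /factor1 fa_quotient ?norm_conjC // -scalemxAl scalerA -/c.
have -> : (sqrtC c)^-1 * (a`_0 / sqrtC c) = a`_0 / c.
  by rewrite mulrCA -invfM -expr2 sqrtCK.
rewrite /su11_mx /schur_a /schur_b !(hornerD, hornerN, hornerZ).
rewrite !horner_recip //.
rewrite !(rmorphB, rmorphM) /= !conjCK TC fmorphV /= xC mul_mx2 scale_mx2.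
have : c != 0 by rewrite gt_eqF.
rewrite /c normCK => {}c0.
by congr mx2; field; rewrite ?c0 ?x0 ?T0.
Qed.

Lemma schur_pos_factorization m D a b : su11_pair m D a b -> 0 < D ->
  schur_pos m a b -> exists eta : nat -> C,
  (forall i, (i <= m)%N -> `|eta i| < 1) /\
  forall t, `|t| = 1 -> (sqrtC D)^-1 *: su11_mx a b t =
    \prod_(i < m.+1) factor1 (m - i)%N (eta (m - i)%N) t.
Proof.
elim: m D a b => [|m IH] D a b ab D0 /=.
  case=> a0 _; have [sa sb _ _] := ab; have De := su11_pair0 ab.
  have c0 : 0 < a`_0 ^+ 2 - `|b`_0| ^+ 2 by rewrite -De.
  exists (fun=> (b`_0)^* / a`_0); split=> [i _|t t1].
    by apply: quotient_lt1; rewrite ?norm_conjC.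
  rewrite big_ord_recl big_ord0 mulr1 (su11_mx_peel t1 sa sb a0 c0) -De.
  rewrite scalerA -invfM -expr2.
  (* At level 0 the step leaves the constant pair (D, 0). *)
  have -> : schur_a 0 a b = D%:P.
    apply/polyP=> -[|k]; rewrite coefC /= ?schur_a0 ?gtr0_real //.
    rewrite coefB !coefZ coef_recip /= mulr0 subr0.
    by rewrite [a`_k.+1]nth_default ?mulr0 // (leq_trans sa).
  have -> : schur_b 0 a b = 0.
    apply/polyP=> -[|k]; rewrite coef0.
      by rewrite schur_b0 conj_Creal ?gtr0_real // mulrC subrr.
    rewrite coefB !coefZ coef_recip /= mulr0 subr0.
    by rewrite [b`_k.+1]nth_default ?mulr0 // (leq_trans sb).
  rewrite sqrtCK /su11_mx horner0 hornerC conjC0 (conj_Creal (gtr0_real D0)).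
  rewrite scalemxAr scale_mx2 mulVf ?gt_eqF // mulr0 mx2_1.
  exact: mulmx1.
case=> a0 pos; have [eta [eta1 He]] := IH _ _ _ (su11_pair_step ab)
  (mulr_gt0 (schur_pos_gt0 pos) D0) pos.
have c0 := schur_pos_gt0 pos; rewrite schur_a0 ?gtr0_real // in c0 He.
exists (fun i => if i == m.+1 then (b`_m.+1)^* / a`_0 else eta i); split.
  move=> i; case: eqP => [_ _|ne].
    by apply: quotient_lt1; rewrite ?norm_conjC.
  by rewrite leq_eqVlt => /orP[/eqP//|]; rewrite ltnS; exact: eta1.
move=> t t1; rewrite big_ord_recl subn0 eqxx.
have -> : \prod_(i < m.+1) factor1 (m.+1 - lift ord0 i)
    (if (m.+1 - lift ord0 i)%N == m.+1 then (b`_m.+1)^* / a`_0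
     else eta (m.+1 - lift ord0 i)%N) t =
  \prod_(i < m.+1) factor1 (m - i)%N (eta (m - i)%N) t.
  apply: eq_bigr => i _; rewrite lift0 subSS.
  by rewrite ltn_eqF // ltnS leq_subr.
have [sa sb _ _] := ab.
rewrite -He // (su11_mx_peel t1 sa sb a0 c0) scalerA -mulmxE.
rewrite -scalemxAr; congr (_ *: _).
by rewrite sqrtCM ?nnegrE ?ltW // invfM mulrC.
Qed.

(** * Products of elementary factors *)

Lemma fa_gt0 w : `|w| < 1 -> 0 < fa w.
Proof.
by move=> w1; rewrite invr_gt0 sqrtC_gt0 subr_gt0 exprn_ilt1 //.
Qed.

Lemma factor1_su11_mx m a b w t : `|t| = 1 -> `|w| < 1 ->
  (size a <= m.+1)%N -> (size b <= m.+1)%N ->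
  factor1 m w t *m su11_mx a b t =
  su11_mx (fa w *: (a + w^* *: recip m b)) (fa w *: (b + w^* *: recip m a)) t.
Proof.
move=> t1 w1 sa sb; have faC : (fa w)^* = fa w.
  by rewrite conj_Creal // gtr0_real // fa_gt0.
have TC : (t ^+ m)^* = (t ^+ m)^-1 by rewrite rmorphXn /= circle_conj // exprVn.
rewrite /factor1 /su11_mx !(hornerZ, hornerD) !horner_recip //.
rewrite !(rmorphM, rmorphD) /= !conjCK faC TC -scalemxAl mul_mx2 scale_mx2.
by congr mx2; congr (_ * _); ring.
Qed.

Lemma su11_mx10 t : su11_mx 1 0 t = 1.
Proof. by rewrite /su11_mx horner0 hornerC conjC0 conjC1 mx2_1. Qed.

(** Neither a(0) nor b(0) receives a contribution from the reciprocals, whose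
   constant terms are coefficients beyond the degree of the shorter product. *)
Lemma factorization_pair m (eta : nat -> C) :
  (forall i, (i <= m)%N -> `|eta i| < 1) -> exists a b,
  [/\ (size a <= m.+1)%N, (size b <= m.+1)%N,
      a`_0 = \prod_(0 <= i < m.+1) fa (eta i),
      b`_0 = (eta 0)^* * \prod_(0 <= i < m.+1) fa (eta i) &
      forall t, `|t| = 1 ->
        \prod_(i < m.+1) factor1 (m - i)%N (eta (m - i)%N) t = su11_mx a b t].
Proof.
have sz k p q u v : (size p <= k.+1)%N ->
    (size (u *: (p + v *: recip k q))%R <= k.+1)%N.
  move=> sp; rewrite (leq_trans (size_scale_leq _ _)) //.
  rewrite (leq_trans (size_polyD _ _)) //.
  by rewrite geq_max sp (leq_trans (size_scale_leq _ _)) ?size_recip.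
elim: m => [|m IH] eta1.
  exists (fa (eta 0) *: (1 + (eta 0)^* *: recip 0 0)),
         (fa (eta 0) *: (0 + (eta 0)^* *: recip 0 1)); split.
  - by rewrite sz // size_poly1.
  - by rewrite sz // size_poly0.
  - by rewrite coefZ coefD coefZ coef_recip0 coef0 conjC0 coef1 mulr0 addr0
       big_nat1 mulr1.
  - by rewrite coefZ coefD coefZ coef_recip0 coef0 coef1 conjC1 add0r mulr1
       big_nat1 mulrC.
  - move=> t t1; rewrite big_ord_recl big_ord0 subn0.
    rewrite -factor1_su11_mx ?eta1 ?su11_mx10 //.
    + by rewrite size_poly1.
    + by rewrite size_poly0.
case: IH => [i im|a [b [sa sb a0 b0 ab]]]; first by rewrite eta1 // ltnW.
have sa' := leq_trans sa (leqnSn _); have sb' := leq_trans sb (leqnSn _).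
exists (fa (eta m.+1) *: (a + (eta m.+1)^* *: recip m.+1 b)),
       (fa (eta m.+1) *: (b + (eta m.+1)^* *: recip m.+1 a)); split.
- exact: sz.
- exact: sz.
- rewrite coefZ coefD coefZ coef_recip0 (nth_default _ sb) conjC0 mulr0 addr0 a0.
  by rewrite [RHS]big_nat_recr //= mulrC.
- rewrite coefZ coefD coefZ coef_recip0 (nth_default _ sa) conjC0 mulr0 addr0 b0.
  by rewrite [in RHS]big_nat_recr //= mulrC mulrA.
- by move=> t t1; rewrite big_ord_recl subn0 -factor1_su11_mx ?eta1 // -ab.
Qed.

(** Y is the inverse of a modulo a power of z, times z^n b^*: then z^-n Y is the
   off-diagonal entry of the lower triangular factor. It has terms z^-n, ..., z^0
   for d = 1, as in part (I), and z^-n, ..., z^-1 for d = 0, as in part (II). *)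
Lemma triangular_quotient n d a b : a`_0 != 0 ->
  a * recip n a - b * recip n b = 'X^n -> exists Y p q : {poly C},
  [/\ (size Y <= n + d)%N, recip n b = Y * a + 'X^n * ('X^d * p),
      recip n a = Y * b + 'X^n * q & a * q = 1 + b * ('X^d * p)].
Proof.
move=> a0 ab.
have cop k : coprimep a 'X^k.
  rewrite coprimep_expr // -['X]subr0 -polyC0 coprimep_XsubC.
  by rewrite rootE horner_coef0.
have /Bezout_eq1_coprimepP[[u v] /= uv] := cop (n + d)%N.
pose Y := (u * recip n b) %% 'X^(n + d).
have sY : (size Y <= n + d)%N.
  rewrite -ltnS -[X in (_ < X)%N](size_polyXn C) ltn_modp.
  exact: monic_neq0 (monicXn C _).
have /dvdpP[p hp] : 'X^(n + d) %| recip n b - Y * a.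
  have -> : recip n b - Y * a =
      (v * recip n b + (u * recip n b) %/ 'X^(n + d) * a) * 'X^(n + d).
    rewrite -[recip n b in LHS]mul1r -uv [_ * recip n b in LHS]mulrDl.
    rewrite mulrAC {1}(divp_eq (u * recip n b) 'X^(n + d)) -/Y; ring.
  exact: dvdp_mull.
have e : a * (recip n a - Y * b) = 'X^n * (1 + b * ('X^d * p)).
  move: hp; rewrite exprD => /eqP; rewrite subr_eq => /eqP hp.
  by rewrite mulrBr -(subrK (b * recip n b) (a * _)) ab hp; ring.
have /dvdpP[q hq] : 'X^n %| recip n a - Y * b.
  by rewrite -(Gauss_dvdpr _ (_ : coprimep _ a)) ?e ?dvdp_mulr // coprimep_sym.
exists Y, p, q; split=> //.
- by apply/eqP; rewrite -subr_eq0 opprD addrA hp exprD subr_eq0; apply/eqP; ring.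
- by apply/eqP; rewrite -subr_eq0 opprD addrA hq subr_eq0; apply/eqP; ring.
- apply: (mulfI (monic_neq0 (monicXn C n))).
  by rewrite -e hq; ring.
Qed.
End Pairs.

(** * Loops given by pairs of polynomials *)

Section Loops.
Variable C : numClosedFieldType.
Implicit Types (a b p q : {poly C}) (t w : C) (m n : nat) (z : circle C).

Lemma circle_norm z : `|val z| = 1.
Proof. exact: eqP (valP z). Qed.

Lemma forall_circle (P : C -> Prop) :
  (forall z, P (val z)) -> forall t, `|t| = 1 -> P t.
Proof. by move=> Pz t /eqP t1; exact: (Pz (exist _ t t1)). Qed.

Lemma SU11_mx2 w1 w2 w3 w4 : SU11 (mx2 w1 w2 w3 w4) ->
  [/\ `|w1| ^+ 2 - `|w2| ^+ 2 = 1, w3 = w2^* & w4 = w1^*].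
Proof. by case=> x [y [xy /mx2_inj[-> -> -> ->]]]. Qed.

Lemma SU11_swapmx (M : 'M[C]_2) : SU11 (swapmx M) -> SU11 M.
Proof.
case=> x [y [xy /(congr1 (@swapmx C))]]; rewrite swapmxK swap_mx2 => ->.
by exists (x^*), (y^*); rewrite !norm_conjC !conjCK.
Qed.

Definition pair_loop n a b (g : loop C) :=
  [/\ su11_pair n 1 a b, 0 < a`_0 & forall z, g z = su11_mx a b (val z)].

(** This turns the loops of part (II) into loops of the kind of part (I). *)
Definition swap_loop (g : loop C) : loop C := fun z => swapmx (g z).

Lemma su11_pair_loop n a b (g : loop C) : (forall z, SU11 (g z)) ->
  (size a <= n.+1)%N -> (size b <= n.+1)%N -> 0 < a`_0 ->
  (forall z, g z = su11_mx a b (val z)) -> pair_loop n a b g.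
Proof.
move=> gSU sa sb a0 gab; split=> //.
apply: su11_pair_circle; rewrite ?gtr0_real //.
by apply: forall_circle => z; have := gSU z; rewrite gab => /SU11_mx2[].
Qed.

Lemma form1E n (g : loop C) : (forall z, SU11 (g z)) ->
  form1 n g <-> exists a b, pair_loop n a b g.
Proof.
move=> gSU; split=> [[a [b [sa sb a0 gab]]]|[a [b [[sa sb _ _] a0 gab]]]].
  exists a, b; apply: su11_pair_loop; rewrite -?horner_coef0 // => z.
  by rewrite gab !pstar_circle ?circle_norm.
exists a, b; split; rewrite ?horner_coef0 // => z.
by rewrite gab /= !pstar_circle ?circle_norm.
Qed.

(** That d has degree at most n - 1 is automatic: by su11_pair_top its coefficient
   of index n is proportional to c(0). *)
Lemma form2E n (g : loop C) : (0 < n)%N -> (forall z, SU11 (g z)) ->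
  form2 n g <-> exists d c, pair_loop n d c (swap_loop g) /\ c`_0 = 0.
Proof.
move=> n0 gSU; split=> [[c [d [sc sd c0 d0 gcd]]]|[d [c [[ab d0 gcd] c0]]]].
  exists d, c; rewrite -horner_coef0; split=> //.
  apply: su11_pair_loop; rewrite -?horner_coef0 // ?(leq_trans sd) // => z.
    by apply: SU11_swapmx; rewrite /swap_loop swapmxK.
  by rewrite /swap_loop gcd swap_mx2 !pstar_circle ?circle_norm.
exists c, d; rewrite !horner_coef0; case: (ab) => sd sc _ _; split=> // [|z /=].
  apply/leq_sizeP=> j; rewrite leq_eqVlt => /orP[/eqP<-|nj].
    have /eqP := su11_pair_top n0 ab.
    by rewrite c0 conjC0 mulr0 mulf_eq0 conjC_eq0 (gt_eqF d0) orbF => /eqP.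
  by rewrite nth_default // (leq_trans sd).
rewrite -[g z]swapmxK -/(swap_loop g z) gcd swap_mx2.
by rewrite !pstar_circle ?circle_norm.
Qed.

Lemma horner_conj_div n p t : (size p <= n.+1)%N -> `|t| = 1 ->
  (p.[t])^* = t ^- n * (recip n p).[t].
Proof.
by move=> sp t1; rewrite horner_recip // mulKf // expf_neq0 // circle_neq0.
Qed.

Lemma horner_negative n p t : (size p <= n.+1)%N -> `|t| = 1 ->
  t ^- n * p.[t] = \sum_(0 <= j < n.+1) p`_(n - j) * t ^- j.
Proof.
move=> sp t1; rewrite big_mkord (horner_coef_wide _ sp) mulr_sumr.
rewrite (reindex_inj rev_ord_inj) /=; apply: eq_bigr => i _.
rewrite subSS mulrCA; congr (_ * _).
rewrite exprB -1?ltnS ?unitfE ?circle_neq0 // mulKf //.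
by rewrite expf_neq0 // circle_neq0.
Qed.

(** If p had degree k > n, then z^k p^* would be divisible by z, although its
   constant term is the conjugate of the leading coefficient of p. *)
Lemma size_le_of_conj n p q :
  (forall t, `|t| = 1 -> (p.[t])^* = t ^- n * q.[t]) -> (size p <= n.+1)%N.
Proof.
move=> pq; rewrite leqNgt; apply/negP => np.
have [k sp kn] : exists2 k, size p = k.+1 & (n < k)%N.
  by exists (size p).-1; rewrite ?(ltn_predK np) // -ltnS (ltn_predK np).
have e : recip k p = 'X^(k - n) * q.
  apply: circle_poly_eq => t t1; rewrite horner_recip ?sp // hornerM hornerXn.
  rewrite pq // mulrA; congr (_ * _).
  by rewrite exprB ?unitfE ?circle_neq0 // ltnW.
have : (recip k p)`_0 == 0 by rewrite e coefXnM subn_gt0 kn.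
rewrite coef_recip0 conjC_eq0 -[k]/(k.+1.-1) -sp -/(lead_coef p) lead_coef_eq0.
by rewrite -size_poly_eq0 sp.
Qed.

(** * Triangular factorizations *)

Lemma mxevalE (M : 'M[{poly C}]_2) t : mxeval M t =
  mx2 (M ord0 ord0).[t] (M ord0 1).[t] (M 1 ord0).[t] (M 1 1).[t].
Proof. by rewrite [LHS]mx2E; congr mx2; rewrite mxE. Qed.

Lemma unipotent_upperP w1 w2 w3 w4 :
  unipotent_upper (mx2 w1 w2 w3 w4) <-> [/\ w1 = 1, w3 = 0 & w4 = 1].
Proof.
split=> [[/is_trig_mxP tr dg]|[-> -> ->]].
  split; [have := dg ord0|have := tr ord0 1 isT|have := dg 1]; by rewrite !mxE.
split.
  by apply/is_trig_mxP=> -[[|[|//]] ?] [[|[|//]] ?] //= _; rewrite !mxE.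
by move=> -[[|[|//]] ?]; rewrite !mxE.
Qed.

Lemma pair_loop_uniq n a b a' b' g : pair_loop n a b g ->
  (forall z, g z = su11_mx a' b' (val z)) -> a = a' /\ b = b'.
Proof.
move=> [_ _ gab] gab'; split; apply: circle_poly_eq; apply: forall_circle => z;
  by have := gab z; rewrite gab' => /mx2_inj[].
Qed.

Lemma pair_triangular1 n a b g : pair_loop n a b g -> has_triangular1 n g.
Proof.
case=> -[sa sb _ ab] a0 gab; have a0' : a`_0 != 0 by rewrite gt_eqF.
rewrite scale1r in ab.
have [Y [p [q [sY hb ha hq]]]] := triangular_quotient 1 a0' ab.
rewrite addn1 in sY; rewrite expr1 in hb hq.
exists (fun j => (Y`_(n - j))^*), a`_0,
  (mx2 ((a`_0)^-1 *: a) ((a`_0)^-1 *: b) (a`_0 *: ('X * p)) (a`_0 *: q)).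
split=> // [|z /=]; rewrite mxevalE !mxE /=.
  rewrite unipotent_upperP !hornerZ !hornerM hornerX mul0r mulr0 !horner_coef0.
  split=> //; first by rewrite mulVf.
  have := congr1 (horner^~ 0) hq; rewrite /= hornerD !hornerM hornerC hornerX.
  by rewrite mul0r mulr0 addr0 !horner_coef0.
rewrite gab; set t := val z; have t1 : `|t| = 1 by exact: circle_norm.
under eq_bigr do rewrite conjCK.
rewrite -horner_negative // !mul_mx2 !hornerZ /su11_mx.
rewrite !(horner_conj_div _ t1 (n := n)) //.
rewrite ha hb !(hornerD, hornerM, hornerXn, hornerX, hornerZ).
have : t ^+ n != 0 by rewrite expf_neq0 // circle_neq0.
by move=> tn0; congr mx2; field; rewrite ?a0' ?tn0.
Qed.

(** The second row of g is conjugate to the first on the circle, and the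
   factorization shows that it has no term below z^-n. *)
Lemma triangular1_pair n (g : loop C) y (a1 : C) M : (forall z, SU11 (g z)) ->
  triangular1 n g y a1 M -> exists a b, pair_loop n a b g /\ a`_0 = a1.
Proof.
move=> gSU [a10]; rewrite mxevalE unipotent_upperP => -[M00 _ _] gM.
pose a := a1 *: M ord0 ord0; pose b := a1 *: M ord0 1.
have aa1 : a`_0 = a1 by rewrite coefZ -horner_coef0 M00 mulr1.
exists a, b; split=> //.
pose Y : {poly C} := \poly_(k < n.+1) (y (n - k)%N)^*.
have sY : (size Y <= n.+1)%N by exact: size_poly.
have gE z : g z = mx2 a.[val z] b.[val z]
  (val z ^- n * (Y * a + 'X^n * (a1^-1 *: M 1 ord0)).[val z])
  (val z ^- n * (Y * b + 'X^n * (a1^-1 *: M 1 1)).[val z]).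
  rewrite gM mxevalE; set t := val z; have t1 : `|t| = 1 by exact: circle_norm.
  have -> : \sum_(0 <= j < n.+1) (y j)^* * t ^- j = t ^- n * Y.[t].
    rewrite horner_negative // !big_mkord; apply: eq_bigr => i _.
    by rewrite coef_poly ltnS leq_subr subKn // -ltnS.
  rewrite !mul_mx2 !(hornerD, hornerM, hornerXn, hornerX, hornerZ).
  have tn0 : t ^+ n != 0 by rewrite expf_neq0 // circle_neq0.
  by congr mx2; field; rewrite ?(gt_eqF a10) ?tn0.
have gab z : g z = su11_mx a b (val z).
  by have := gSU z; rewrite gE => /SU11_mx2[_ e1 e2]; rewrite /su11_mx; congr mx2.
apply: su11_pair_loop => //.
- apply: size_le_of_conj; apply: forall_circle => z.
  by have := gab z; rewrite gE => /mx2_inj[_ _ _ <-].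
- apply: size_le_of_conj; apply: forall_circle => z.
  by have := gab z; rewrite gE => /mx2_inj[_ _ <-].
- by rewrite aa1.
Qed.

Lemma horner_negative1 n p t : (size p <= n)%N -> `|t| = 1 ->
  t ^- n * p.[t] = \sum_(1 <= j < n.+1) p`_(n - j) * t ^- j.
Proof.
move=> sp t1; rewrite horner_negative ?(leq_trans sp) // big_ltn //.
by rewrite subn0 nth_default // mul0r add0r.
Qed.

Lemma swap_loopE (g : loop C) a b z :
  swap_loop g z = su11_mx a b (val z) <->
  g z = mx2 (a.[val z])^* (b.[val z])^* b.[val z] a.[val z].
Proof.
rewrite -(swap_mx2 a.[val z]) -/(su11_mx a b (val z)) /swap_loop.
by split=> [<-|->]; rewrite swapmxK.
Qed.

(** The polynomial factor is unipotent at 0 because c(0) = 0 gives d(0) q(0) = 1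
   in triangular_quotient. *)
Lemma pair_triangular2 n d c g : pair_loop n d c (swap_loop g) -> c`_0 = 0 ->
  has_triangular2 n g.
Proof.
case=> -[sd sc _ dc] d0 gdc c0; have d0' : d`_0 != 0 by rewrite gt_eqF.
rewrite scale1r in dc.
have [Y [p [q [sY hc hd hq]]]] := triangular_quotient 0 d0' dc.
rewrite addn0 in sY; rewrite expr0 mul1r in hc hq.
exists (fun j => (Y`_(n - j))^*), (d`_0)^-1,
  (mx2 (d`_0 *: q) (d`_0 *: p) ((d`_0)^-1 *: c) ((d`_0)^-1 *: d)).
split=> [||z /=]; first by rewrite invr_gt0.
  rewrite mxevalE !mxE /= unipotent_upperP !hornerZ !horner_coef0 c0.
  rewrite mulr0 mulVf //; split=> //; have := congr1 (horner^~ 0) hq.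
  by rewrite /= hornerD !hornerM hornerC !horner_coef0 c0 mul0r addr0.
rewrite mxevalE !mxE /=.
have /swap_loopE -> := gdc z; set t := val z.
have t1 : `|t| = 1 by exact: circle_norm.
under eq_bigr do rewrite conjCK.
rewrite -horner_negative1 // !mul_mx2 !hornerZ.
rewrite !(horner_conj_div _ t1 (n := n)) //.
rewrite hc hd !(hornerD, hornerM, hornerXn).
have : t ^+ n != 0 by rewrite expf_neq0 // circle_neq0.
by move=> tn0; congr mx2; field; rewrite ?d0' ?tn0.
Qed.

Lemma triangular2_pair n (g : loop C) x (a2 : C) M : (forall z, SU11 (g z)) ->
  triangular2 n g x a2 M ->
  exists d c, [/\ pair_loop n d c (swap_loop g), c`_0 = 0 & d`_0 = a2^-1].
Proof.
move=> gSU [a20]; rewrite mxevalE unipotent_upperP => -[_ M10 M11] gM.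
pose c := a2^-1 *: M 1 ord0; pose d := a2^-1 *: M 1 1.
have d0 : d`_0 = a2^-1 by rewrite coefZ -horner_coef0 M11 mulr1.
have c0 : c`_0 = 0 by rewrite coefZ -horner_coef0 M10 mulr0.
exists d, c; split=> //.
pose Y : {poly C} := \poly_(k < n) (x (n - k)%N)^*.
have sY : (size Y <= n)%N by exact: size_poly.
have gE z : g z = mx2
  (val z ^- n * (Y * c + 'X^n * (a2 *: M ord0 ord0)).[val z])
  (val z ^- n * (Y * d + 'X^n * (a2 *: M ord0 1)).[val z])
  c.[val z] d.[val z].
  rewrite gM mxevalE; set t := val z; have t1 : `|t| = 1 by exact: circle_norm.
  have -> : \sum_(1 <= j < n.+1) (x j)^* * t ^- j = t ^- n * Y.[t].
    rewrite horner_negative1 //; apply: eq_big_nat => i /andP[i0 ltin].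
    have n0 : (0 < n)%N by exact: leq_trans i0 ltin.
    by rewrite coef_poly ltn_subrL i0 n0 subKn.
  rewrite !mul_mx2 !(hornerD, hornerM, hornerXn, hornerZ).
  have tn0 : t ^+ n != 0 by rewrite expf_neq0 // circle_neq0.
  by congr mx2; field; rewrite ?(gt_eqF a20) ?tn0.
have gdc z : g z = mx2 (d.[val z])^* (c.[val z])^* c.[val z] d.[val z].
  by have := gSU z; rewrite gE => /SU11_mx2[_ -> ->]; rewrite !conjCK.
apply: su11_pair_loop => //.
- by move=> z; apply: SU11_swapmx; rewrite /swap_loop swapmxK.
- apply: size_le_of_conj; apply: forall_circle => z.
  by have := gdc z; rewrite gE => /mx2_inj[<-].
- apply: size_le_of_conj; apply: forall_circle => z.
  by have := gdc z; rewrite gE => /mx2_inj[_ <-].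
- by rewrite d0 invr_gt0.
- by move=> z; apply/swap_loopE.
Qed.

(** * Elementary factorizations of loops *)

Lemma factorization1_pair n (g : loop C) eta : (forall z, SU11 (g z)) ->
  factorization1 n g eta -> exists a b,
  [/\ pair_loop n a b g, a`_0 = \prod_(0 <= i < n.+1) fa (eta i) &
      b`_0 = (eta 0)^* * \prod_(0 <= i < n.+1) fa (eta i)].
Proof.
move=> gSU [eta1 geta].
have [a [b [sa sb a0 b0 ab]]] := factorization_pair eta1.
exists a, b; split=> //; apply: su11_pair_loop => // [|z].
  rewrite a0 big_mkord; apply: prodr_gt0 => i _.
  by rewrite fa_gt0 // eta1 // -ltnS.
by rewrite geta ab // circle_norm.
Qed.

Lemma swap_factor2 k w t : swapmx (factor2 k w t) = factor1 k w t.
Proof. by rewrite /factor2 /factor1 !scale_mx2 swap_mx2. Qed.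

Lemma fa0 : fa 0 = 1 :> C.
Proof. by rewrite /fa normr0 expr0n subr0 sqrtC1 invr1. Qed.

(** The factor of index 0 with parameter 0 is the identity. *)
Lemma swap_factorization n (g : loop C) zeta eta :
  eta 0 = 0 -> (forall k, (0 < k)%N -> eta k = zeta k) ->
  factorization2 n g zeta <-> factorization1 n (swap_loop g) eta.
Proof.
move=> eta0 ez.
have sw z : swapmx (\prod_(i < n) factor2 (n - i)%N (zeta (n - i)%N) (val z)) =
    \prod_(i < n.+1) factor1 (n - i)%N (eta (n - i)%N) (val z).
  rewrite big_ord_recr /= subnn eta0.
  have -> : factor1 0 0 (val z) = 1.
    by rewrite /factor1 fa0 scale1r conjC0 !mul0r mx2_1.
  rewrite mulr1 (big_morph _ (@swapmxM C) (_ : swapmx 1 = 1)).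
    apply: eq_bigr => i _.
    by rewrite swap_factor2 ez // subn_gt0.
  by rewrite -mx2_1 swap_mx2.
split=> -[le1 gE]; split.
- by move=> [|i] lein; rewrite ?eta0 ?normr0 // ez // le1.
- by move=> z; rewrite -sw -gE.
- by move=> k /andP[k0 kn]; rewrite -ez // le1.
- by move=> z; rewrite -[LHS]swapmxK -/(swap_loop g z) gE -sw swapmxK.
Qed.

(** * Continuity of the Schur algorithm *)

Lemma conj_continuous : continuous (@Num.conj C).
Proof.
move=> x s /(nbhs_ballP (x^*)) [e e0 es].
apply/nbhs_ballP; exists e => //= y; rewrite /ball /= => xy.
by apply: es; rewrite /ball /= -rmorphB norm_conjC.
Qed.

Lemma entry_continuous m n1 n2 k i j :
  continuous (fun A : 'rV['M[C]_(n1, n2)]_m => A ord0 k i j).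
Proof.
move=> A s /= /(nbhs_ballP (A ord0 k i j)) [e e0 es].
apply/nbhs_ballP; exists e => //= B [_ AB].
by apply: es; have [_] := AB ord0 k; apply.
Qed.

Section Clopen.
Variables (T : topologicalType) (K : set T).
Implicit Types (f : T -> C) (u v : T -> {poly C}).

Definition coef_continuous u := forall k, continuous (fun x => (u x)`_k).

Lemma closed_zero f : continuous f -> closed [set x | f x = 0].
Proof.
move=> cf; have /continuous_closedP/(_ [set 0]) := cf; apply.
exact/accessible_closed_set1/hausdorff_accessible/norm_hausdorff.
Qed.

Lemma closed_ge0 f : continuous f -> closed [set x | 0 <= f x].
Proof.
move=> cf; rewrite (_ : [set x | _] = [set x | `|f x| - f x = 0]).
  apply: closed_zero => x; apply: cvgB; last exact: cf.
  by apply: cvg_norm; exact: cf.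
by apply/seteqP; split=> x /=; rewrite ger0_def -subr_eq0 => /eqP.
Qed.

Lemma open_gt0 f : continuous f -> open [set x | `|f x| + f x != 0].
Proof.
move=> cf; rewrite (_ : [set x | _] = ~` [set x | `|f x| + f x = 0]).
  apply: closed_openC; apply: closed_zero => x; apply: cvgD; last exact: cf.
  by apply: cvg_norm; exact: cf.
by apply/seteqP; split=> x /=; [move/eqP|move=> ?; apply/eqP].
Qed.

(** The order of the complex field is partial and its positive elements do not
   form an open set; on real numbers, positivity is the open condition
   |w| + w != 0. *)
Lemma real_gt0 w : w \is Num.real -> (0 < w) = (`|w| + w != 0).
Proof.
case/real_ge0P => [w0|w0]; last by rewrite addNr eqxx lt_gtF.
by rewrite -mulr2n mulrn_eq0 /= lt0r w0 andbT.
Qed.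

Lemma schur_step_continuous m u v : coef_continuous u -> coef_continuous v ->
  coef_continuous (fun x => schur_a m (u x) (v x)) /\
  coef_continuous (fun x => schur_b m (u x) (v x)).
Proof.
have st (u1 u2 v1 v2 : T -> {poly C}) l : coef_continuous u1 ->
    coef_continuous u2 -> coef_continuous v1 -> coef_continuous v2 ->
  coef_continuous (fun x => (u1 x)`_0 *: u2 x - (v1 x)`_l *: recip m (v2 x)).
  move=> cu1 cu2 cv1 cv2 k x.
  under eq_fun do rewrite coefB !coefZ coef_recip.
  apply: cvgB; first by apply: cvgM; [exact: cu1|exact: cu2].
  apply: cvgM; first exact: cv1.
  case: ifP => _; last exact: cvg_cst.
  exact: (continuous_comp (@cv2 _ x) (@conj_continuous _)).
by move=> cu cv; split; apply: st.
Qed.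

Lemma schur_pos_open m (D : T -> C) u v :
  coef_continuous u -> coef_continuous v ->
  (forall x, K x -> su11_pair m (D x) (u x) (v x)) ->
  exists2 U, open U & forall x, K x -> U x <-> schur_pos m (u x) (v x).
Proof.
elim: m D u v => [|m IH] D u v cu cv Kuv.
  exists [set x | `|(u x)`_0| + (u x)`_0 != 0]; first exact/open_gt0/cu.
  move=> x /Kuv[_ _ ur _] /=; rewrite (real_gt0 ur); tauto.
have [cu' cv'] := schur_step_continuous m.+1 cu cv.
have [U oU UP] := IH _ _ _ cu' cv' (fun x Kx => su11_pair_step (Kuv x Kx)).
exists ([set x | `|(u x)`_0| + (u x)`_0 != 0] `&` U).
  by apply: openI => //; exact/open_gt0/cu.
move=> x Kx; have [_ _ ur _] := Kuv x Kx.
by rewrite /= (real_gt0 ur) -UP.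
Qed.

Lemma schur_bound_closed m (D : T -> C) u v :
  continuous D -> coef_continuous u -> coef_continuous v ->
  closed [set x | schur_bound m (D x) (u x) (v x)].
Proof.
elim: m D u v => [|m IH] D u v cD cu cv /=; first exact: closedT.
have [cu' cv'] := schur_step_continuous m.+1 cu cv.
apply: closedI; last by apply: IH => // x; apply: cvgM; [exact: cu'|exact: cD].
rewrite [X in closed X](_ : _ =
  [set x | 0 <= (schur_a m.+1 (u x) (v x))`_0 - D x]); last first.
  by apply/funext=> x; rewrite /mkset subr_ge0.
by apply: closed_ge0 => x; apply: cvgB; [exact: cu'|exact: cD].
Qed.

(** On K, success of the algorithm is an open condition (schur_pos), and
   equivalent to a closed one (schur_bound). *)
Lemma connected_schur_pos n u v x0 : connected K ->
  coef_continuous u -> coef_continuous v ->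
  (forall x, K x -> su11_pair n 1 (u x) (v x) /\ 0 < (u x)`_0) ->
  K x0 -> schur_pos n (u x0) (v x0) ->
  forall x, K x -> schur_pos n (u x) (v x).
Proof.
move=> conK cu cv Kuv Kx0 pos0.
have [U oU UP] := schur_pos_open cu cv (fun x Kx => (Kuv x Kx).1).
have c1 : continuous ((fun=> 1) : T -> C) by move=> x; exact: cvg_cst.
have cF := schur_bound_closed (m := n) (D := fun=> 1) c1 cu cv.
set F := [set x | _] in cF.
suff <- : K `&` U = K by move=> x [Kx /(UP x Kx)].
apply: conK; [by exists x0; split=> //; apply/UP|by exists U|exists F => //].
apply/seteqP; split=> x [Kx]; have [uv u0] := Kuv x Kx; split=> //.
  by apply: schur_pos_bound; [|exact: ltr01|apply/UP].
by apply/UP => //; apply: (schur_bound_pos ltr01).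
Qed.

End Clopen.

(** * The identity component *)

(** The coefficients of non-negative frequency of an entry; the coefficient of
   z^k is stored at index n + k. *)
Definition entry_poly n (A : 'rV['M[C]_2]_(n.*2.+1)) i j : {poly C} :=
  \poly_(k < n.+1) A ord0 (inord (n + k)) i j.

Lemma entry_poly_continuous n i j :
  coef_continuous (fun A => @entry_poly n A i j).
Proof.
move=> k; have [kn|kn] := ltnP k n.+1.
  rewrite [X in continuous X](_ : _ =
      fun A : 'rV['M[C]_2]_(n.*2.+1) => A ord0 (inord (n + k)) i j).
    exact: entry_continuous.
  by apply/funext=> A; rewrite coef_poly kn.
rewrite [X in continuous X](_ : _ = fun=> 0); first exact: cst_continuous.
by apply/funext=> A; rewrite coef_poly ltnNge kn.
Qed.

Lemma laurent_entry n (A : 'rV['M[C]_2]_(n.*2.+1)) i j p : (size p <= n.+1)%N ->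
  (forall z, laurent A z i j = p.[val z]) -> p = entry_poly A i j.
Proof.
move=> sp Ap.
pose q : {poly C} := \poly_(k < n.*2.+1) A ord0 (inord k) i j.
have e : 'X^n * p = q.
  apply: circle_poly_eq; apply: forall_circle => z.
  rewrite hornerM hornerXn -Ap /laurent summxE horner_poly mulr_sumr.
  have z0 : val z != 0 by rewrite circle_neq0 ?circle_norm.
  apply: eq_bigr => k _; rewrite mxE inord_val mulrA [RHS]mulrC.
  by rewrite expfzDr // -exprnP -exprnN mulrCA divff ?mulr1 // expf_neq0.
apply/polyP=> k; rewrite coef_poly; case: ltnP => kn.
  have := congr1 (fun s : {poly C} => s`_(n + k)) e.
  rewrite coefXnM ltnNge leq_addr /= addKn => ->.
  by rewrite coef_poly ifT // ltnS -addnn leq_add2l -ltnS.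
by rewrite nth_default // (leq_trans sp).
Qed.

Lemma entry_poly_one n i j : entry_poly (laurent_one C n) i j = (i == j)%:R.
Proof.
apply/polyP=> k; rewrite coef_poly !mxE; case: ltnP => kn.
  rewrite inordK; last by rewrite ltnS -addnn leq_add2l.
  rewrite -[X in _ == X]addn0 eqn_add2l -polyC_natr coefC.
  by case: eqP => _; rewrite !mxE.
by rewrite -polyC_natr coefC; case: k kn.
Qed.

Lemma schur_pos10 m : schur_pos m (1 : {poly C}) 0.
Proof.
elim: m => [|m IH] /=; rewrite coef1 /= ?ltr01 //; split=> //.
rewrite /schur_a /schur_b coef0 coef1 scale0r subr0 scaler0 scale0r.
by rewrite scale1r subr0.
Qed.

Lemma pair_loop_factorization n a b g : pair_loop n a b g -> schur_pos n a b ->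
  exists eta, factorization1 n g eta.
Proof.
move=> [ab a0 gab] pos.
have [eta [eta1 etaE]] := schur_pos_factorization ab ltr01 pos.
exists eta; split=> // z; rewrite gab -etaE ?circle_norm //.
by rewrite sqrtC1 invr1 scale1r.
Qed.

Definition pad0 (zeta : nat -> C) k := if k == 0 then 0 else zeta k.

Lemma factorization2_pad0 n (g : loop C) zeta : factorization2 n g zeta ->
  factorization1 n (swap_loop g) (pad0 zeta).
Proof. by apply: (swap_factorization n g _ _).1 => // -[]. Qed.

(** Uniform in the position of the polynomial row of the matrix, which is the
   first one in part (I) and the second one in part (II). *)
Lemma id_component_schur_pos n (S : set (loop C)) i j (g : loop C) a b :
  i != j ->
  (forall f, S f -> exists p q, [/\ su11_pair n 1 p q, 0 < p`_0 &
     forall z, f z i i = p.[val z] /\ f z i j = q.[val z]]) ->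
  (size a <= n.+1)%N -> (size b <= n.+1)%N ->
  (forall z, g z i i = a.[val z] /\ g z i j = b.[val z]) ->
  id_component n S g -> schur_pos n a b.
Proof.
move=> ij SE sa sb gE [A [K [K1 KS conK] KA] eA].
have aA : a = entry_poly A i i.
  by apply: laurent_entry => // z; rewrite eA; have [] := gE z.
have bA : b = entry_poly A i j.
  by apply: laurent_entry => // z; rewrite eA; have [] := gE z.
rewrite aA bA.
apply: (connected_schur_pos (u := fun A => entry_poly A i i)
          (v := fun A => entry_poly A i j) conK _ _ _ K1) => //.
- exact: entry_poly_continuous.
- exact: entry_poly_continuous.
- move=> B /KS /SE[p [q [pq p0 E]]]; have [sp sq _ _] := pq.
  rewrite -(laurent_entry sp (fun z => (E z).1)).
  by rewrite -(laurent_entry sq (fun z => (E z).2)).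
- by rewrite !entry_poly_one eqxx (negPf ij); exact: schur_pos10.
Qed.

Lemma id_component_sub n (S : set (loop C)) : id_component n S `<=` S.
Proof. by move=> g [A [K [_ KS _] KA] <-]; exact: KS. Qed.

Lemma id_component1_factorization n (g : loop C) :
  id_component n [set f | Lfin_SU11 f /\ form1 n f] g -> has_factorization1 n g.
Proof.
move=> gS; have [[gSU _] /form1E-/(_ gSU)[a [b gab]]] := id_component_sub gS.
have [[sa sb _ _] _ gE] := gab.
apply: (pair_loop_factorization gab).
apply: (id_component_schur_pos (i := ord0) (j := 1) _ _ sa sb _ gS) => //.
  move=> f [[fSU _] /form1E-/(_ fSU)[p [q [pq p0 fE]]]]; exists p, q.
  by split=> // z; rewrite fE !mxE.
by move=> z; rewrite gE !mxE.
Qed.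

Lemma id_component2_factorization n (g : loop C) : (0 < n)%N ->
  id_component n [set f | Lfin_SU11 f /\ form2 n f] g -> has_factorization2 n g.
Proof.
move=> n0 gS.
have [[gSU _] /(form2E n0)-/(_ gSU)[d [c [gdc c0]]]] := id_component_sub gS.
have gSU' z : SU11 (swap_loop g z).
  by apply: SU11_swapmx; rewrite /swap_loop swapmxK.
have [[sd sc _ _] d0 gE] := gdc.
have [|eta He] := pair_loop_factorization gdc.
  apply: (id_component_schur_pos (i := 1) (j := ord0) _ _ sd sc _ gS) => //.
    move=> f [[fSU _] /(form2E n0)-/(_ fSU)[p [q [[pq p0 fE] _]]]].
    by exists p, q; split=> // z; have /swap_loopE -> := fE z; rewrite !mxE.
  by move=> z; have /swap_loopE -> := gE z; rewrite !mxE.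
(* The constant term of c vanishes, and it is eta_0^* times a nonzero product. *)
exists eta; apply/(@swap_factorization _ g eta eta) => //.
have [d' [c' [[_ d'0 gE'] d'E c'0]]] := factorization1_pair gSU' He.
have [_ cc'] := pair_loop_uniq gdc gE'.
move/eqP: c'0; rewrite -cc' c0 eq_sym -d'E mulf_eq0 conjC_eq0 (gt_eqF d'0) orbF.
by move/eqP.
Qed.
End Loops.

Theorem theorem0p1 (R : realType) (n : nat) (hn : (0 < n)%N) :
  (forall g1 : loop R[i], Lfin_SU11 g1 ->
     [/\ form1 n g1 <-> has_triangular1 n g1,
         has_factorization1 n g1 -> form1 n g1 /\ has_triangular1 n g1,
         id_component n [set g : loop R[i] | Lfin_SU11 g /\ form1 n g] g1 ->
           has_factorization1 n g1 &
         forall (eta y : nat -> R[i]) (a1 : R[i]) (M : 'M[{poly R[i]}]_2),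
           factorization1 n g1 eta -> triangular1 n g1 y a1 M ->
           a1 = \prod_(0 <= i < n.+1) fa (eta i)]) /\
  (forall g2 : loop R[i], Lfin_SU11 g2 ->
     [/\ form2 n g2 <-> has_triangular2 n g2,
         has_factorization2 n g2 -> form2 n g2 /\ has_triangular2 n g2,
         id_component n [set g : loop R[i] | Lfin_SU11 g /\ form2 n g] g2 ->
           has_factorization2 n g2 &
         forall (zeta x : nat -> R[i]) (a2 : R[i]) (M : 'M[{poly R[i]}]_2),
           factorization2 n g2 zeta -> triangular2 n g2 x a2 M ->
           a2^-1 = \prod_(1 <= k < n.+1) fa (zeta k)]).
Proof.
split=> g [gSU _].
- have tri : form1 n g <-> has_triangular1 n g.
    rewrite form1E //; split=> [[a [b]]|[y [a1 [M]]]].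
      exact: pair_triangular1.
    by move=> /(triangular1_pair gSU)[a [b [ab _]]]; exists a, b.
  split=> //.
  + case=> eta /(factorization1_pair gSU)[a [b [ab _ _]]].
    have fg : form1 n g by apply/form1E => //; exists a, b.
    by split=> //; apply/tri.
  + exact: id_component1_factorization.
  + move=> eta y a1 M /(factorization1_pair gSU)[a [b [[_ _ gab] <- _]]].
    move=> /(triangular1_pair gSU)[a' [b' [ab' <-]]].
    by have [->] := pair_loop_uniq ab' gab.
- have gSU' z : SU11 (swap_loop g z).
    by apply: SU11_swapmx; rewrite /swap_loop swapmxK.
  have tri : form2 n g <-> has_triangular2 n g.
    rewrite form2E //; split=> [[d [c [dc c0]]]|[x [a2 [M]]]].
      exact: pair_triangular2 dc c0.
    by move=> /(triangular2_pair gSU)[d [c [dc c0 _]]]; exists d, c.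
  split=> //.
  + case=> zeta /factorization2_pad0.
    move=> /(factorization1_pair gSU')[d [c [dc _ c0]]].
    have fg : form2 n g.
      by apply/form2E => //; exists d, c; rewrite c0 conjC0 mul0r.
    by split=> //; apply/tri.
  + exact: id_component2_factorization.
  + move=> zeta x a2 M /factorization2_pad0.
    move=> /(factorization1_pair gSU')[d [c [[_ _ gdc] d0 _]]].
    move=> /(triangular2_pair gSU)[d' [c' [/pair_loop_uniq/(_ gdc)[e _] _ <-]]].
    rewrite e d0 big_ltn // /pad0 eqxx fa0 mul1r.
    by apply: eq_big_nat => -[].
Qed.
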